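(* Let $r\neq 0$ be a number, let $p(x)=\sum_{n=0}^{\deg p}p_nx^n$ be a non-zero polynomial, and let $g(x)=\sum_{n\ge 0}g_nx^n$ be a power series which is the expansion of $$g(x)=\frac{1}{\sqrt[r]{p(x)}}.$$ Then the coefficients of $g$ obey the recurrence $$\sum_{t=0}^{\deg p}(rn-rt+t)\,p_t\,g_{n-t}=0\qquad\text{for all integers } n\ge \deg p+1 .$$
   Context: Polynomials have complex coefficients and $r$ is a non-zero complex number (not required to be an integer or positive). $\sqrt[r]{p(x)}=p(x)^{1/r}$ denotes an analytic branch, i.e. $\exp(\frac1r L(x))$ where $L$ is analytic with $\exp(L(x))=p(x)$. The statement that the power series $g(x)=\sum_{n\ge0}g_nx^n$ is the expansion of the given expression means: $g$ has a positive radius of convergence, and on some non-empty open connected subset of its disc of convergence $g$ equals the given expression for some choice of analytic branch of the root (the expression being well defined there). *)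

(* Defs.v *)
From Stdlib Require Import Reals.
From Coquelicot Require Import Coquelicot.

Notation C := Coquelicot.Complex.C.

Open Scope C_scope.

Definition Cexp (z : C) : C :=
  ((exp (fst z) * cos (snd z))%R, (exp (fst z) * sin (snd z))%R).

(* A polynomial of degree d is given by its coefficients p 0, ..., p d, with
   the side condition p d <> 0 stated where it is used (so it is non-zero);
   coefficients of index larger than d are ignored. *)
Definition poly_eval (d : nat) (p : nat -> C) (x : C) : C :=
  sum_n (fun t : nat => p t * x ^ t) d.

Definition C_connected (U : C -> Prop) : Prop :=
  forall A B : C -> Prop,
    open A -> open B ->
    (forall x : C, U x -> A x \/ B x) ->
    (exists x : C, U x /\ A x) ->
    (exists x : C, U x /\ B x) ->
    exists x : C, U x /\ A x /\ B x.

(* Only applied to open U, so that the behaviour of f outside U is irrelevant. *)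
Definition analytic_on (U : C -> Prop) (f : C -> C) : Prop :=
  forall a : C, U a ->
    exists (c : nat -> C) (eps : R),
      (0 < eps)%R /\
      forall x : C, (Cmod (x - a) < eps)%R -> is_pseries c (x - a) (f x).

(* [CV_radius] is defined for real coefficients as the supremum of the radii of
   absolute convergence, which only depends on the moduli of the coefficients. *)
Definition C_radius (g : nat -> C) : Rbar :=
  CV_radius (fun n : nat => Cmod (g n)).

(* f is, on U, an analytic branch of the r-th root of q. *)
Definition is_root_branch (r : C) (q : C -> C) (U : C -> Prop) (f : C -> C)
    : Prop :=
  exists L : C -> C,
    analytic_on U L /\
    (forall x : C, U x -> Cexp (L x) = q x) /\
    (forall x : C, U x -> f x = Cexp (1 / r * L x)).

Definition is_expansion_inv_root (r : C) (q : C -> C) (g : nat -> C) : Prop :=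
  Rbar_lt 0%R (C_radius g) /\
  exists (U : C -> Prop) (f : C -> C),
    open U /\
    C_connected U /\
    (exists x : C, U x) /\
    (forall x : C, U x -> Rbar_lt (Cmod x) (C_radius g)) /\
    is_root_branch r q U f /\
    (forall x : C, U x -> f x <> 0 /\ is_pseries g x (1 / f x)).

(* Main.v *)
Require Import Defs.
From Stdlib Require Import Reals Factorial Lra Lia.
From Coquelicot Require Import Coquelicot.

(* On U, write p = exp L and g = exp (- L / r). Then p' = L' p and r g' = - L' g,
   so r p (x g') + (x p') g = 0 on U; the left-hand side is a power series whose
   coefficient of index n >= d is the sum of the theorem. As U need not contain 0,
   an identity theorem is required: a power series vanishing on a non-empty open
   subset of its disc of convergence is zero. Everything is differentiated and
   compared along real rays t |-> t a only, which reduces the complex statements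
   to real power series: x g' at a is the derivative of t |-> g (t a) at t = 1,
   and the real identity theorem follows from the Taylor-Lagrange formula, whose
   remainder tends to 0 on steps of a fixed length leading from t = 1 to 0. *)

Open Scope R_scope.

(** * The identity theorem for real power series, through estimates of derivatives *)

Lemma ex_pseries_CV_radius (a : nat -> R) (x : R) :
  ex_pseries a x -> Rbar_le (Rabs x) (CV_radius a).
Proof.
  intros Ha.
  destruct (Rbar_le_lt_dec (Rabs x) (CV_radius a)) as [H | H]; [exact H | exfalso].
  apply (CV_disk_outside a x H).
  apply ex_series_lim_0.
  apply ex_pseries_R, Ha.
Qed.

(** Cauchy's estimate: for [s] inside the disc the terms [a n * s ^ n] tend to 0, hence are bounded.
    Taking [s] strictly beyond [Rabs x] leaves the margin from which the step length of the
    continuation is drawn. *)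
Lemma CV_radius_bounded_coeffs (a : nat -> R) (x : R) :
  Rbar_lt (Rabs x) (CV_radius a) ->
  exists s M : R, Rabs x < s /\ Rbar_lt s (CV_radius a) /\
    forall n : nat, Rabs (a n) <= M / s ^ n.
Proof.
  intros Hx.
  assert (exists s : R, Rabs x < s /\ Rbar_lt s (CV_radius a)) as (s & Hs & Hs').
  { destruct (CV_radius a) as [c | | ]; simpl in Hx.
    - exists ((Rabs x + c) / 2). simpl. lra.
    - exists (Rabs x + 1). simpl. split; [lra | exact I].
    - contradiction. }
  assert (Hs0 : 0 < s) by (generalize (Rabs_pos x); lra).
  assert (Hl : is_lim_seq (fun n => a n * s ^ n) 0).
  { apply ex_series_lim_0, ex_series_Rabs, CV_disk_inside.
    now rewrite Rabs_pos_eq by lra. }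
  destruct (filterlim_bounded (K := R_AbsRing) (V := R_NormedModule)
              (fun n => a n * s ^ n)) as [M HM].
  { exists 0. exact Hl. }
  exists s, M; repeat split; [exact Hs | exact Hs' |].
  intros n. assert (Hp : 0 < s ^ n) by now apply pow_lt.
  apply Rmult_le_reg_r with (s ^ n); [exact Hp |].
  replace (M / s ^ n * s ^ n) with M by (field; lra).
  rewrite <- (Rabs_pos_eq (s ^ n)) at 1 by lra.
  rewrite <- Rabs_mult. exact (HM n).
Qed.

(** Closed form of the majorant used to bound the derivatives of a general power series. *)
Lemma Derive_n_inv_1_minus (n : nat) (q : R) :
  Rabs q < 1 ->
  Derive_n (fun y => / (1 - y)) n q = INR (fact n) / (1 - q) ^ S n.
Proof.
  revert q; induction n as [| n IH]; intros q Hq.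
  - assert (q < 1) by (apply Rabs_lt_between in Hq; lra). simpl. field. lra.
  - assert (q < 1) by (apply Rabs_lt_between in Hq; lra).
    change (Derive (Derive_n (fun y => / (1 - y)) n) q
            = INR (fact (S n)) / (1 - q) ^ S (S n)).
    apply is_derive_unique.
    (* The induction hypothesis holds only on the unit disc, so it is used on the ball of radius
       [1 - Rabs q] around [q]. *)
    apply is_derive_ext_loc with (fun y => INR (fact n) / (1 - y) ^ S n).
    + assert (He : 0 < 1 - Rabs q) by lra.
      exists (mkposreal _ He). intros y Hy. symmetry. apply IH.
      unfold ball in Hy; simpl in Hy; unfold AbsRing_ball, abs, minus, plus, opp in Hy.
      simpl in Hy.
      replace y with (q + (y + - q)) by ring.
      eapply Rle_lt_trans; [apply Rabs_triang | lra].
    + assert (Hn : (1 - q) ^ n <> 0) by (apply pow_nonzero; lra).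
      auto_derive.
      * change ((1 - q) ^ S n <> 0). apply pow_nonzero; lra.
      * change (match n with 0%nat => 1 | S _ => INR n + 1 end) with (INR (S n)).
        rewrite fact_simpl, mult_INR. simpl pow. unfold Rminus in *.
        generalize dependent ((1 + - q) ^ n). intros z Hz.
        field. split; [exact Hz | lra].
Qed.

(** The geometric series is differentiated [n] times, once term by term and once through its sum
    [/ (1 - y)]. *)
Lemma is_series_PS_derive_n_geom (n : nat) (q : R) :
  Rabs q < 1 ->
  is_series (fun k => INR (fact (k + n)) / INR (fact k) * q ^ k)
            (INR (fact n) / (1 - q) ^ S n).
Proof.
  intros Hq.
  assert (Hr : forall y, Rabs y < 1 -> Rbar_lt (Rabs y) (CV_radius (fun _ => 1))).
  { intros y Hy.
    (* Convergence at a point bounds the radius only weakly; the midpoint of [Rabs y] and 1 makes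
       the inequality strict. *)
    apply Rbar_lt_le_trans with (Rabs ((Rabs y + 1) / 2)).
    - simpl. rewrite (Rabs_pos_eq ((Rabs y + 1) / 2)); generalize (Rabs_pos y); lra.
    - apply ex_pseries_CV_radius, ex_pseries_R.
      apply ex_series_ext with (fun k => ((Rabs y + 1) / 2) ^ k); [intros k; symmetry; apply Rmult_1_l |].
      apply ex_series_geom. rewrite (Rabs_pos_eq ((Rabs y + 1) / 2)); generalize (Rabs_pos y); lra. }
  rewrite <- Derive_n_inv_1_minus by exact Hq.
  rewrite <- (Derive_n_ext_loc (PSeries (fun _ => 1))).
  - rewrite Derive_n_PSeries by now apply Hr.
    assert (H : ex_pseries (PS_derive_n n (fun _ => 1)) q).
    { apply CV_radius_inside. rewrite CV_radius_derive_n. now apply Hr. }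
    apply PSeries_correct, is_pseries_R in H.
    revert H. apply is_series_ext. intros k. unfold PS_derive_n. now rewrite Rmult_1_r.
  - assert (He : 0 < 1 - Rabs q) by lra.
    exists (mkposreal _ He). intros y Hy.
    rewrite <- Series_geom.
    + apply Series_ext. intros k; apply Rmult_1_l.
    + unfold ball in Hy; simpl in Hy; unfold AbsRing_ball, abs, minus, plus, opp in Hy.
      simpl in Hy.
      replace y with (q + (y + - q)) by ring.
      eapply Rle_lt_trans; [apply Rabs_triang | lra].
Qed.

(** The series is dominated by that of [M * s / (s - y)], with coefficients [M / s ^ k]; the bound
    is the [n]-th derivative of this majorant at [Rabs x]. *)
Lemma Derive_n_PSeries_bound (a : nat -> R) (s M x : R) (n : nat) :
  Rabs x < s -> Rbar_lt s (CV_radius a) ->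
  (forall k, Rabs (a k) <= M / s ^ k) ->
  Rabs (Derive_n (PSeries a) n x) <= M * s * INR (fact n) / (s - Rabs x) ^ S n.
Proof.
  intros Hx Hs Ha.
  assert (Hs0 : 0 < s) by (generalize (Rabs_pos x); lra).
  assert (HM : forall k, 0 < s ^ k) by (intros k; now apply pow_lt).
  assert (Hdiv : forall u k, (u / s) ^ k = u ^ k / s ^ k).
  { intros u k. unfold Rdiv. now rewrite Rpow_mult_distr, pow_inv. }
  assert (Hxr : Rbar_lt (Rabs x) (CV_radius a)).
  { now apply Rbar_lt_trans with s. }
  rewrite Derive_n_PSeries by exact Hxr.
  assert (Hq : Rabs (Rabs x / s) < 1).
  { rewrite Rabs_pos_eq.
    - apply Rmult_lt_reg_r with s; [exact Hs0 |]. unfold Rdiv.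
      rewrite Rmult_assoc, Rinv_l; lra.
    - apply Rdiv_le_0_compat; [apply Rabs_pos | exact Hs0]. }
  assert (Hser := is_series_scal (M / s ^ n) _ _ (is_series_PS_derive_n_geom n _ Hq)).
  replace (M * s * INR (fact n) / (s - Rabs x) ^ S n)
    with (M / s ^ n * (INR (fact n) / (1 - Rabs x / s) ^ S n)).
  2: { replace (1 - Rabs x / s) with ((s - Rabs x) / s) by (field; lra).
       rewrite Hdiv.
       simpl pow.
       field. repeat split; try lra; apply pow_nonzero; lra. }
  eapply Rle_trans; [| right; exact (is_series_unique _ _ Hser)].
  eapply Rle_trans.
  { apply Series_Rabs, CV_disk_inside. now rewrite CV_radius_derive_n. }
  apply Series_le; [intros k; split; [apply Rabs_pos |] |].
  2: { now exists (M / s ^ n * (INR (fact n) / (1 - Rabs x / s) ^ S n)). }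
  unfold PS_derive_n.
  rewrite !Rabs_mult, <- RPow_abs.
  rewrite (Rabs_pos_eq (INR _ / _)).
  2: { apply Rdiv_le_0_compat; [apply pos_INR | apply INR_fact_lt_0]. }
  change (scal (M / s ^ n) ?z) with (M / s ^ n * z).
  apply Rle_trans with
    (INR (fact (k + n)) / INR (fact k) * (M / s ^ (k + n)) * Rabs x ^ k).
  - apply Rmult_le_compat_r; [apply pow_le, Rabs_pos |].
    apply Rmult_le_compat_l; [| apply Ha].
    apply Rdiv_le_0_compat; [apply pos_INR | apply INR_fact_lt_0].
  - right. rewrite Hdiv, pow_add.
    field. repeat split; try apply INR_fact_neq_0; apply pow_nonzero; lra.
Qed.

(* Taylor-Lagrange at x: the bound on the derivatives makes the n-th remainder
   at most [K * ((y - x) / (s - b)) ^ n]. *)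
Lemma PSeries_zero_step (a : nat -> R) (s M b x y : R) :
  b < s -> Rbar_lt s (CV_radius a) ->
  (forall k, Rabs (a k) <= M / s ^ k) ->
  Rabs x <= b -> Rabs y <= b -> x < y < x + (s - b) ->
  (forall n, Derive_n (PSeries a) n x = 0) ->
  PSeries a y = 0.
Proof.
  intros Hb Hs Ha Hx Hy Hxy Hd.
  assert (Hb0 : 0 <= b) by (generalize (Rabs_pos x); lra).
  assert (HM : 0 <= M).
  { generalize (Ha 0%nat) (Rabs_pos (a 0%nat)); simpl; lra. }
  set (q := (y - x) / (s - b)).
  assert (Hq : 0 <= q < 1).
  { unfold q; split.
    - apply Rdiv_le_0_compat; lra.
    - apply Rmult_lt_reg_r with (s - b); [lra |].
      unfold Rdiv. rewrite Rmult_assoc, Rinv_l; lra. }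
  assert (Hbet : forall t, x <= t <= y -> Rabs t <= b).
  { intros t Ht. apply Rabs_le. apply Rabs_le_between in Hx, Hy. lra. }
  assert (H : forall n, Rabs (PSeries a y) <= M * s / (s - b) * q ^ S n).
  { intros n.
    destruct (Taylor_Lagrange (PSeries a) n x y) as (z & Hz & ->); [lra | |].
    { intros t Ht k _. apply ex_derive_n_PSeries.
      apply Rbar_le_lt_trans with s; [| exact Hs].
      simpl. generalize (Hbet t Ht); lra. }
    assert (Hzb : Rabs z <= b) by (apply Hbet; lra).
    (* All Taylor coefficients at [x] vanish, so the remainder alone is left. *)
    rewrite (sum_eq_R0 _ n) by (intros k _; rewrite Hd; ring).
    rewrite Rplus_0_l, Rabs_mult, Rabs_pos_eq.
    2: { apply Rdiv_le_0_compat; [apply pow_le; lra | apply INR_fact_lt_0]. }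
    apply Rle_trans with ((y - x) ^ S n / INR (fact (S n)) *
                          (M * s * INR (fact (S n)) / (s - b) ^ S (S n))).
    - apply Rmult_le_compat_l.
      { apply Rdiv_le_0_compat; [apply pow_le; lra | apply INR_fact_lt_0]. }
      eapply Rle_trans; [apply Derive_n_PSeries_bound; try eassumption; lra |].
      apply Rmult_le_compat_l.
      { repeat apply Rmult_le_pos; try lra. apply pos_INR. }
      apply Rinv_le_contravar; [apply pow_lt; lra | apply pow_incr; lra].
    - right. unfold q, Rdiv. rewrite Rpow_mult_distr, pow_inv.
      change ((s - b) ^ S (S n)) with ((s - b) * (s - b) ^ S n).
      field. repeat split; try lra; try apply INR_fact_neq_0; apply pow_nonzero; lra. }
  assert (Hl : is_lim_seq (fun n => M * s / (s - b) * q ^ S n) 0).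
  { replace (Finite 0) with (Rbar_mult (M * s / (s - b)) 0) by (simpl; f_equal; ring).
    apply is_lim_seq_scal_l, (is_lim_seq_incr_1 (fun n => q ^ n)), is_lim_seq_geom.
    rewrite Rabs_pos_eq; lra. }
  assert (Hle := is_lim_seq_le _ _ _ _ H (is_lim_seq_const _) Hl). simpl in Hle.
  generalize (Rabs_pos (PSeries a y)); intros Hp.
  destruct (Req_dec (PSeries a y) 0) as [E | E]; [exact E |].
  apply Rabs_pos_lt in E; lra.
Qed.

(** Local vanishing is carried rightwards from [x0] to 0 in finitely many steps shorter than
    [s - b]; at 0 the coefficients are determined by the function. The sign of [x0] matches the
    direction of the Taylor step, which goes from [x] to a larger [y]. *)
Lemma PSeries_locally_zero_neg (a : nat -> R) (x0 : R) (n : nat) :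
  x0 < 0 -> Rbar_lt (Rabs x0) (CV_radius a) ->
  locally x0 (fun x => PSeries a x = 0) -> a n = 0.
Proof.
  intros Hx0 Hr Hloc.
  destruct (CV_radius_bounded_coeffs a x0 Hr) as (s & M & Hs & Hs' & Ha).
  rewrite Rabs_left in Hs by exact Hx0.
  (* The midpoint of [- x0] and [s]: the path stays in the interval of radius [b], and [s - b]
     bounds the step length uniformly. *)
  set (b := (s - x0) / 2).
  assert (Hb : - x0 < b < s) by (unfold b; lra).
  assert (Hstep : forall x y, locally x (fun t => PSeries a t = 0) ->
            x0 <= x -> x < y <= 0 -> y < x + (s - b) ->
            locally y (fun t => PSeries a t = 0)).
  { intros x y Hx Hxx Hxy Hyd.
    (* The three bounds keep [z] below [b] (as [y <= 0]), to the right of [x], and within one step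
       of [x]; [- b <= z] then follows from [x0 <= x]. *)
    set (e := Rmin (b + x0) (Rmin (y - x) (x + (s - b) - y))).
    assert (He : 0 < e) by (repeat apply Rmin_pos; lra).
    exists (mkposreal e He). intros z Hz.
    change (Rabs (z - y) < e) in Hz.
    assert (e <= b + x0) by apply Rmin_l.
    assert (e <= y - x) by (eapply Rle_trans; [apply Rmin_r | apply Rmin_l]).
    assert (e <= x + (s - b) - y) by (eapply Rle_trans; [apply Rmin_r | apply Rmin_r]).
    apply Rabs_lt_between in Hz.
    apply (PSeries_zero_step a s M b x z); try assumption; try lra.
    - apply Rabs_le; lra.
    - apply Rabs_le; lra.
    - intros k. rewrite (Derive_n_ext_loc _ (fun _ => 0) k x Hx).
      destruct k; [reflexivity | apply Derive_n_const]. }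
  (* [N] equal steps of length [- x0 / INR N] lead exactly from [x0] to 0. *)
  destruct (INR_archimed (s - b) (- x0)) as [N HN]; [lra |].
  assert (HN0 : 0 < INR N).
  { destruct (pos_INR N) as [H | H]; [exact H | rewrite <- H in HN; lra]. }
  assert (Hdelta : 0 < - x0 / INR N < s - b).
  { split; [apply Rdiv_lt_0_compat; lra |].
    apply Rmult_lt_reg_r with (INR N); [exact HN0 |].
    unfold Rdiv. rewrite Rmult_assoc, Rinv_l; lra. }
  assert (Hk : forall k, (k <= N)%nat ->
             locally (x0 + INR k * (- x0 / INR N)) (fun t => PSeries a t = 0)).
  { induction k as [| k IH]; intros HkN.
    - simpl. replace (x0 + 0 * (- x0 / INR N)) with x0 by ring. exact Hloc.
    - assert (HkN' : INR (S k) <= INR N) by now apply le_INR.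
      assert (E : INR N * (- x0 / INR N) = - x0) by (field; lra).
      apply (Hstep (x0 + INR k * (- x0 / INR N))).
      + apply IH; lia.
      + generalize (Rmult_le_pos _ _ (pos_INR k) (Rlt_le _ _ (proj1 Hdelta))). lra.
      + apply (Rmult_le_compat_r (- x0 / INR N)) in HkN'; [| lra].
        rewrite E in HkN'. rewrite S_INR in *. lra.
      + rewrite S_INR. lra. }
  assert (H0 := Hk N (le_n N)).
  replace (x0 + INR N * (- x0 / INR N)) with 0 in H0 by (field; lra).
  apply (PSeries_ext_recip a (fun _ => 0)).
  - apply Rbar_le_lt_trans with (Rabs x0); [apply Rabs_pos | exact Hr].
  - now rewrite CV_radius_const_0.
  - revert H0. apply filter_imp. intros t ->. symmetry. apply PSeries_const_0.
Qed.

Lemma PSeries_locally_zero (a : nat -> R) (x0 : R) (n : nat) :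
  Rbar_lt (Rabs x0) (CV_radius a) ->
  locally x0 (fun x => PSeries a x = 0) -> a n = 0.
Proof.
  intros Hr Hloc.
  destruct (Rtotal_order x0 0) as [H | [-> | H]].
  - now apply PSeries_locally_zero_neg with x0.
  - apply (PSeries_ext_recip a (fun _ => 0)).
    + now rewrite Rabs_R0 in Hr.
    + now rewrite CV_radius_const_0.
    + revert Hloc. apply filter_imp. intros t ->. symmetry. apply PSeries_const_0.
  (* A positive point is reduced to a negative one by the reflection [x -> - x], which multiplies
     the [n]-th coefficient by [(-1) ^ n] and preserves absolute convergence. *)
  - assert (E : (-1) ^ n * a n = 0).
    { apply (PSeries_locally_zero_neg (fun k => (-1) ^ k * a k) (- x0)); [lra | |].
      - rewrite Rabs_Ropp.
        destruct (CV_radius_bounded_coeffs a x0 Hr) as (s & _ & Hs & Hs' & _).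
        assert (Hs0 : 0 < s) by (generalize (Rabs_pos x0); lra).
        apply Rbar_lt_le_trans with (Rabs s); [rewrite (Rabs_pos_eq s); simpl; lra |].
        apply ex_pseries_CV_radius, ex_pseries_R, ex_series_Rabs.
        apply ex_series_ext with (fun k => Rabs (a k * s ^ k)).
        + intros k. now rewrite Rmult_assoc, (Rabs_mult ((-1) ^ k)), pow_1_abs, Rmult_1_l.
        + apply CV_disk_inside. now rewrite (Rabs_pos_eq s) by lra.
      - destruct Hloc as [e He]. exists e. intros y Hy.
        rewrite <- (He (- y)).
        + apply Series_ext. intros k. replace (- y) with (-1 * y) by ring.
          rewrite Rpow_mult_distr. ring.
        + change (Rabs (- y - x0) < e). change (Rabs (y - - x0) < e) in Hy.
          rewrite <- Rabs_Ropp. replace (- (- y - x0)) with (y - - x0) by ring. exact Hy. }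
    apply Rmult_integral in E. destruct E as [E | E]; [| exact E].
    exfalso. revert E. apply pow_nonzero. lra.
Qed.

(** * Complex power series restricted to real rays *)

Lemma fst_sum_n (u : nat -> Defs.C) (n : nat) :
  fst (sum_n u n) = sum_n (fun k => fst (u k)) n.
Proof.
  induction n as [| n IH].
  - now rewrite !sum_O.
  - now rewrite !sum_Sn, <- IH.
Qed.

Lemma snd_sum_n (u : nat -> Defs.C) (n : nat) :
  snd (sum_n u n) = sum_n (fun k => snd (u k)) n.
Proof.
  induction n as [| n IH].
  - now rewrite !sum_O.
  - now rewrite !sum_Sn, <- IH.
Qed.

Lemma is_series_C (u : nat -> Defs.C) (l : Defs.C) :
  is_series u l <->
  is_series (fun n => fst (u n)) (fst l) /\ is_series (fun n => snd (u n)) (snd l).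
Proof.
  unfold is_series. split.
  - intros H. split.
    + apply filterlim_ext with (fun n => fst (sum_n u n)); [apply fst_sum_n |].
      apply filterlim_comp with (1 := H).
      apply (continuous_fst (U := R_UniformSpace) (V := R_UniformSpace) (fst l) (snd l)).
    + apply filterlim_ext with (fun n => snd (sum_n u n)); [apply snd_sum_n |].
      apply filterlim_comp with (1 := H).
      apply (continuous_snd (U := R_UniformSpace) (V := R_UniformSpace) (fst l) (snd l)).
  - intros [H1 H2]. apply filterlim_locally. intros e.
    generalize (filter_and _ _ (proj1 (filterlim_locally _ _) H1 e)
                  (proj1 (filterlim_locally _ _) H2 e)). apply filter_imp. intros n [Hn1 Hn2].
    split; [rewrite fst_sum_n | rewrite snd_sum_n]; assumption.
Qed.

Lemma C_pow_n (x : Defs.C) (n : nat) : pow_n x n = Cpow x n.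
Proof.
  induction n as [| n IH]; [reflexivity |]. simpl. now rewrite IH.
Qed.

(** The real factor [t ^ n] comes out of [(t a) ^ n], so a complex series on the ray through [a] is
    a pair of real power series in [t]. *)
Lemma is_pseries_C_ray (u : nat -> Defs.C) (a v : Defs.C) (t : R) :
  is_pseries u (RtoC t * a)%C v <->
  is_pseries (fun n => fst (u n * a ^ n)%C) t (fst v) /\
  is_pseries (fun n => snd (u n * a ^ n)%C) t (snd v).
Proof.
  assert (E : forall n, scal (pow_n (RtoC t * a)%C n : C_AbsRing) (u n)
                        = (RtoC (t ^ n) * (u n * a ^ n))%C).
  { intros n. rewrite C_pow_n, Cpow_mult_l, RtoC_pow.
    change (RtoC t ^ n * a ^ n * u n = RtoC t ^ n * (u n * a ^ n))%C. ring. }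
  assert (E1 : forall n, fst (scal (pow_n (RtoC t * a)%C n : C_AbsRing) (u n))
                         = scal (pow_n t n) (fst (u n * a ^ n)%C)).
  { intros n. rewrite E. change (scal (pow_n t n) ?z) with (t ^ n * z). simpl. ring. }
  assert (E2 : forall n, snd (scal (pow_n (RtoC t * a)%C n : C_AbsRing) (u n))
                         = scal (pow_n t n) (snd (u n * a ^ n)%C)).
  { intros n. rewrite E. change (scal (pow_n t n) ?z) with (t ^ n * z). simpl. ring. }
  unfold is_pseries. rewrite is_series_C.
  split; (intros [H1 H2]; split;
    [eapply is_series_ext, H1; intros n;
      first [exact (E1 n) | symmetry; exact (E1 n)]
    | eapply is_series_ext, H2; intros n;
      first [exact (E2 n) | symmetry; exact (E2 n)]]).
Qed.

Lemma locally_ray (U : Defs.C -> Prop) (a : Defs.C) (t0 : R) :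
  open U -> U (RtoC t0 * a)%C -> locally t0 (fun t => U (RtoC t * a)%C).
Proof.
  intros HU Ha.
  destruct (HU _ Ha) as [e He].
  assert (Hm := Cmod_ge_0 a).
  (* The ray is Lipschitz with constant [Cmod a]; the added 1 covers the case [a = 0]. *)
  assert (Hd : 0 < e / (1 + Cmod a)) by (apply Rdiv_lt_0_compat; [apply cond_pos | lra]).
  exists (mkposreal _ Hd). intros t Ht. apply He.
  change (Rabs (t - t0) < e / (1 + Cmod a)) in Ht.
  assert (Hlt : Cmod (RtoC (t - t0) * a) < e).
  { rewrite Cmod_mult, Cmod_R.
    apply Rmult_lt_compat_r with (r := 1 + Cmod a) in Ht; [| lra].
    replace (e / (1 + Cmod a) * (1 + Cmod a)) with (pos e) in Ht by (field; lra).
    generalize (Rabs_pos (t - t0)); lra. }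
  (* Balls of the complex plane are taken coordinatewise here, and each coordinate is bounded by the
     modulus. *)
  generalize (Rmax_Cmod (RtoC (t - t0) * a)%C); intros Hmax.
  split; eapply Rle_lt_trans; [| eapply Rle_lt_trans with (1 := Hmax), Hlt
                              | | eapply Rle_lt_trans with (1 := Hmax), Hlt].
  - eapply Rle_trans; [right | apply Rmax_l].
    change (abs ?z) with (Rabs z). f_equal. simpl.
    unfold minus, plus, opp; simpl. ring.
  - eapply Rle_trans; [right | apply Rmax_r].
    change (abs ?z) with (Rabs z). f_equal. simpl.
    unfold minus, plus, opp; simpl. ring.
Qed.

(** A neighbourhood of [t0] contains a point of larger absolute value where the series still
    converges, which gives the strict inequality. *)
Lemma locally_is_pseries_CV_radius (a : nat -> R) (f : R -> R) (t0 : R) :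
  locally t0 (fun t => is_pseries a t (f t)) -> Rbar_lt (Rabs t0) (CV_radius a).
Proof.
  intros [e He].
  assert (exists t, Rabs t0 < Rabs t /\ Rabs (t - t0) < e) as (t & Ht & Hte).
  { assert (0 < e) by apply cond_pos.
    destruct (Rle_dec 0 t0) as [H0 | H0].
    - exists (t0 + e / 2). split; [rewrite !Rabs_pos_eq; lra |].
      replace (t0 + e / 2 - t0) with (e / 2) by ring. rewrite Rabs_pos_eq; lra.
    - exists (t0 - e / 2). split; [rewrite !Rabs_left; lra |].
      replace (t0 - e / 2 - t0) with (- (e / 2)) by ring.
      rewrite Rabs_Ropp, Rabs_pos_eq; lra. }
  apply Rbar_lt_le_trans with (Rabs t); [exact Ht |].
  apply ex_pseries_CV_radius. exists (f t). apply He. exact Hte.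
Qed.

(** On the ray through a non-zero point [a] of [U], the real identity theorem kills both coordinates
    of [h n * a ^ n]; then [a ^ n] is cancelled. *)
Lemma pseries_C_locally_zero (U : Defs.C -> Prop) (h : nat -> Defs.C) :
  open U -> (exists x, U x) -> (forall x, U x -> is_pseries h x (RtoC 0)) ->
  forall n, h n = RtoC 0.
Proof.
  intros HU [x0 Hx0] Hh n.
  (* If the given point is 0, openness supplies a small positive real point instead. *)
  assert (exists a, U a /\ a <> RtoC 0) as (a & Ha & Ha0).
  { destruct (Ceq_dec x0 (RtoC 0)) as [-> | H]; [| now exists x0].
    destruct (HU _ Hx0) as [e He].
    assert (Hpos : 0 < e) by apply cond_pos.
    exists (RtoC (e / 2)). split.
    - apply He. split; [| apply ball_center].
      change (Rabs (e / 2 - 0) < e). rewrite Rabs_pos_eq; lra.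
    - intros E. apply RtoC_inj in E. lra. }
  assert (Hloc : locally 1 (fun t => is_pseries h (RtoC t * a)%C (RtoC 0))).
  { eapply filter_imp; [intros t Ht; apply Hh, Ht |].
    apply locally_ray; [exact HU | now rewrite Cmult_1_l]. }
  assert (Hz : forall b : nat -> R, locally 1 (fun t => is_pseries b t 0) -> b n = 0).
  { intros b Hb. apply PSeries_locally_zero with 1.
    - now apply locally_is_pseries_CV_radius with (fun _ => 0).
    - revert Hb. apply filter_imp. intros t. apply is_pseries_unique. }
  assert (E : (h n * a ^ n)%C = RtoC 0).
  { apply injective_projections.
    - apply (Hz (fun k => fst (h k * a ^ k)%C)).
      revert Hloc. apply filter_imp. intros t Ht. now apply is_pseries_C_ray in Ht.
    - apply (Hz (fun k => snd (h k * a ^ k)%C)).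
      revert Hloc. apply filter_imp. intros t Ht. now apply is_pseries_C_ray in Ht. }
  destruct (Ceq_dec (h n) (RtoC 0)) as [H | H]; [exact H | exfalso].
  revert E. apply Cmult_neq_0; [exact H | now apply Cpow_nz].
Qed.

(** * Derivatives of complex-valued functions of a real variable *)

(** Coordinatewise, so that the rules below reduce to derivatives of real functions. *)
Definition is_derive_C (f : R -> Defs.C) (t : R) (l : Defs.C) : Prop :=
  is_derive (fun s => fst (f s)) t (fst l) /\ is_derive (fun s => snd (f s)) t (snd l).

Lemma is_derive_C_ext_loc (f g : R -> Defs.C) (t : R) (l : Defs.C) :
  locally t (fun s => f s = g s) -> is_derive_C f t l -> is_derive_C g t l.
Proof.
  intros H [H1 H2]; split; [revert H1 | revert H2]; apply is_derive_ext_loc;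
    revert H; apply filter_imp; now intros s ->.
Qed.

Lemma is_derive_C_unique (f : R -> Defs.C) (t : R) (l1 l2 : Defs.C) :
  is_derive_C f t l1 -> is_derive_C f t l2 -> l1 = l2.
Proof.
  intros [H1 H2] [H3 H4].
  apply injective_projections.
  - now rewrite <- (is_derive_unique _ _ _ H1), <- (is_derive_unique _ _ _ H3).
  - now rewrite <- (is_derive_unique _ _ _ H2), <- (is_derive_unique _ _ _ H4).
Qed.

Lemma is_derive_C_const (c : Defs.C) (t : R) : is_derive_C (fun _ => c) t (RtoC 0).
Proof. split; apply (is_derive_const (V := R_NormedModule)). Qed.

Lemma is_derive_C_plus (f g : R -> Defs.C) (t : R) (lf lg : Defs.C) :
  is_derive_C f t lf -> is_derive_C g t lg ->
  is_derive_C (fun s => f s + g s)%C t (lf + lg)%C.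
Proof. intros [F1 F2] [G1 G2]; split; now apply (is_derive_plus (V := R_NormedModule)). Qed.

Lemma is_derive_C_mult (f g : R -> Defs.C) (t : R) (lf lg : Defs.C) :
  is_derive_C f t lf -> is_derive_C g t lg ->
  is_derive_C (fun s => f s * g s)%C t (lf * g t + f t * lg)%C.
Proof.
  intros [F1 F2] [G1 G2].
  (* The coordinates are abstracted to arbitrary real functions, which [auto_derive] treats as
     atoms. *)
  assert (H : forall (u1 u2 v1 v2 : R -> R) (a1 a2 b1 b2 : R),
    is_derive u1 t a1 -> is_derive u2 t a2 -> is_derive v1 t b1 -> is_derive v2 t b2 ->
    is_derive (fun s => u1 s * v1 s - u2 s * v2 s) t
      (a1 * v1 t - a2 * v2 t + (u1 t * b1 - u2 t * b2)) /\
    is_derive (fun s => u1 s * v2 s + u2 s * v1 s) t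
      (a1 * v2 t + a2 * v1 t + (u1 t * b2 + u2 t * b1))).
  { intros u1 u2 v1 v2 a1 a2 b1 b2 U1 U2 V1 V2.
    split; auto_derive;
      try (repeat split; first [now exists a1 | now exists a2 | now exists b1 | now exists b2]);
      rewrite (is_derive_unique (fun x : R => u1 x) t a1 U1),
              (is_derive_unique (fun x : R => u2 x) t a2 U2),
              (is_derive_unique (fun x : R => v1 x) t b1 V1),
              (is_derive_unique (fun x : R => v2 x) t b2 V2); ring. }
  split; [apply (H _ _ _ _ _ _ _ _ F1 F2 G1 G2) | apply (H _ _ _ _ _ _ _ _ F1 F2 G1 G2)].
Qed.

Lemma is_derive_C_Cexp (f : R -> Defs.C) (t : R) (l : Defs.C) :
  is_derive_C f t l -> is_derive_C (fun s => Cexp (f s)) t (l * Cexp (f t))%C.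
Proof.
  intros [F1 F2].
  assert (H : forall (u v : R -> R) (lu lv : R), is_derive u t lu -> is_derive v t lv ->
    is_derive (fun s => exp (u s) * cos (v s)) t
      (lu * (exp (u t) * cos (v t)) - lv * (exp (u t) * sin (v t))) /\
    is_derive (fun s => exp (u s) * sin (v s)) t
      (lu * (exp (u t) * sin (v t)) + lv * (exp (u t) * cos (v t)))).
  { intros u v lu lv Hu Hv.
    split; auto_derive; try (split; [now exists lu | split; [now exists lv | easy]]);
      rewrite (is_derive_unique (fun x : R => u x) t lu Hu),
              (is_derive_unique (fun x : R => v x) t lv Hv); ring. }
  split; [apply (H _ _ _ _ F1 F2) | apply (H _ _ _ _ F1 F2)].
Qed.

Lemma is_derive_C_comp_shift (f : R -> Defs.C) (t h : R) (l : Defs.C) :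
  is_derive_C f (t + h) l -> is_derive_C (fun s => f (s + h)) t l.
Proof.
  assert (H : forall (u : R -> R) (k : R),
            is_derive u (t + h) k -> is_derive (fun s => u (s + h)) t k).
  { intros u k Hu. auto_derive; [now exists k |].
    rewrite (is_derive_unique (fun x : R => u x) _ k Hu). ring. }
  intros [F1 F2]; split; [apply (H _ _ F1) | apply (H _ _ F2)].
Qed.

(** At [t = 1] the derivative along the ray is the Euler operator [x d/dx] at [a], of which [x ^ k]
    is an eigenvector with eigenvalue [k]. *)
Lemma is_derive_C_ray_pow (a : Defs.C) (k : nat) :
  is_derive_C (fun t => (RtoC t * a) ^ k)%C 1 (RtoC (INR k) * a ^ k)%C.
Proof.
  assert (Hray : is_derive_C (fun t => RtoC t * a)%C 1 a).
  { split; simpl; auto_derive; auto; ring. }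
  induction k as [| k IH].
  - simpl. rewrite Cmult_0_l. apply is_derive_C_const.
  - generalize (is_derive_C_mult _ _ _ _ _ Hray IH).
    rewrite S_INR, RtoC_plus, Cmult_1_l.
    replace ((INR k + 1) * a ^ S k)%C with (a * a ^ k + a * (INR k * a ^ k))%C
      by (simpl; ring).
    exact (fun H => H).
Qed.

Lemma is_derive_C_ray_poly_eval (d : nat) (p : nat -> Defs.C) (a : Defs.C) :
  is_derive_C (fun t => poly_eval d p (RtoC t * a)%C) 1
    (sum_n (fun k => p k * (RtoC (INR k) * a ^ k))%C d).
Proof.
  assert (Hmon : forall k, is_derive_C (fun t => p k * (RtoC t * a) ^ k)%C 1
                             (p k * (RtoC (INR k) * a ^ k))%C).
  { intros k.
    generalize (is_derive_C_mult _ _ _ _ _ (is_derive_C_const (p k) 1)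
                  (is_derive_C_ray_pow a k)).
    rewrite Cmult_0_l, Cplus_0_l. exact (fun H => H). }
  unfold poly_eval. induction d as [| d IH].
  - rewrite sum_O. eapply is_derive_C_ext_loc, Hmon.
    apply filter_forall. intros t. now rewrite sum_O.
  - rewrite sum_Sn. eapply is_derive_C_ext_loc, (is_derive_C_plus _ _ _ _ _ IH (Hmon (S d))).
    apply filter_forall. intros t. now rewrite sum_Sn.
Qed.

(** * The Euler operator on power series and on analytic functions *)

(** Multiplying the derivative by [t0] shifts the derived series by one index, so its coefficients
    become [INR n * a n]. *)
Lemma is_derive_locally_is_pseries (a : nat -> R) (f : R -> R) (t0 : R) :
  locally t0 (fun t => is_pseries a t (f t)) ->
  exists D : R, is_derive f t0 D /\ is_pseries (fun n => INR n * a n) t0 (t0 * D).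
Proof.
  intros H.
  assert (Hr := locally_is_pseries_CV_radius _ _ _ H).
  exists (PSeries (PS_derive a) t0). split.
  - eapply is_derive_ext_loc, is_derive_PSeries, Hr.
    revert H. apply filter_imp. intros t. apply is_pseries_unique.
  - assert (Hd : is_pseries (PS_derive a) t0 (PSeries (PS_derive a) t0)).
    { apply PSeries_correct, CV_radius_inside. now rewrite CV_radius_derive. }
    apply is_pseries_incr_1 in Hd. revert Hd. apply is_pseries_ext.
    (* The shift puts 0 at index 0, in agreement with [INR 0 * a 0]. *)
    intros [| n]; [| reflexivity].
    change (0 = 0 * a 0%nat). ring.
Qed.

Lemma is_derive_C_pseries_ray (u : nat -> Defs.C) (a : Defs.C) (F : R -> Defs.C) (t0 : R) :
  locally t0 (fun t => is_pseries u (RtoC t * a)%C (F t)) ->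
  exists D : Defs.C, is_derive_C F t0 D /\
    is_pseries (fun n => RtoC (INR n) * u n)%C (RtoC t0 * a)%C (RtoC t0 * D)%C.
Proof.
  intros H.
  destruct (is_derive_locally_is_pseries (fun n => fst (u n * a ^ n)%C)
              (fun t => fst (F t)) t0) as (D1 & H1 & H1').
  { revert H. apply filter_imp. intros t Ht. now apply is_pseries_C_ray in Ht. }
  destruct (is_derive_locally_is_pseries (fun n => snd (u n * a ^ n)%C)
              (fun t => snd (F t)) t0) as (D2 & H2 & H2').
  { revert H. apply filter_imp. intros t Ht. now apply is_pseries_C_ray in Ht. }
  exists (D1, D2). split; [now split |].
  apply is_pseries_C_ray. split.
  - replace (fst (RtoC t0 * (D1, D2))%C) with (t0 * D1) by (simpl; ring).
    revert H1'. apply is_pseries_ext. intros n. simpl. ring.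
  - replace (snd (RtoC t0 * (D1, D2))%C) with (t0 * D2) by (simpl; ring).
    revert H2'. apply is_pseries_ext. intros n. simpl. ring.
Qed.

Lemma analytic_on_is_derive_C_ray (U : Defs.C -> Prop) (L : Defs.C -> Defs.C) (a : Defs.C) :
  analytic_on U L -> U a -> exists E, is_derive_C (fun t => L (RtoC t * a)%C) 1 E.
Proof.
  intros HL Ha. destruct (HL a Ha) as (c & eps & Heps & Hc).
  (* The expansion of [L] is centred at [a], and [(t + 1) a - a = t a]; the parameter is moved so
     that the point [a] sits at [t = 0], and moved back to 1 afterwards. *)
  destruct (is_derive_C_pseries_ray c a (fun t => L (RtoC (t + 1) * a)%C) 0) as (E & HE & _).
  { assert (Hm := Cmod_ge_0 a).
    assert (Hd : 0 < eps / (1 + Cmod a)) by (apply Rdiv_lt_0_compat; lra).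
    exists (mkposreal _ Hd). intros t Ht.
    change (Rabs (t - 0) < eps / (1 + Cmod a)) in Ht. rewrite Rminus_0_r in Ht.
    replace (RtoC t * a)%C with (RtoC (t + 1) * a - a)%C by (rewrite RtoC_plus; ring).
    apply Hc.
    replace (RtoC (t + 1) * a - a)%C with (RtoC t * a)%C by (rewrite RtoC_plus; ring).
    rewrite Cmod_mult, Cmod_R.
    apply Rmult_lt_compat_r with (r := 1 + Cmod a) in Ht; [| lra].
    replace (eps / (1 + Cmod a) * (1 + Cmod a)) with eps in Ht by (field; lra).
    generalize (Rabs_pos t); lra. }
  exists E.
  assert (H := is_derive_C_comp_shift (fun t => L (RtoC (t + 1) * a)%C) 1 (- (1)) E).
  rewrite Rplus_opp_r in H. specialize (H HE).
  revert H. apply is_derive_C_ext_loc. apply filter_forall. intros t. simpl in t.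
  now replace (t + - (1) + 1) with t by ring.
Qed.

(** * The differential identity and the comparison of coefficients *)

Lemma is_pseries_sum_n {K : AbsRing} {V : NormedModule K}
    (u : nat -> nat -> V) (x : K) (v : nat -> V) (d : nat) :
  (forall k, is_pseries (u k) x (v k)) ->
  is_pseries (fun n => sum_n (fun k => u k n) d) x (sum_n v d).
Proof.
  intros H. induction d as [| d IH].
  - rewrite sum_O. eapply is_pseries_ext, H. intros n. now rewrite sum_O.
  - rewrite sum_Sn. eapply is_pseries_ext, (is_pseries_plus _ _ _ _ _ IH (H (S d))).
    intros n. now rewrite sum_Sn.
Qed.

(** [D] is the value of [x g'] at [a]. Logarithmic differentiation of both [p] and [g] expresses
    [x p'] and [D] through the ray derivative [E] of [L], and [E] cancels. *)
Lemma inv_root_Euler_identity (r : Defs.C) (d : nat) (p g : nat -> Defs.C)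
    (U : Defs.C -> Prop) (f : Defs.C -> Defs.C) (a : Defs.C) :
  r <> RtoC 0 -> open U -> is_root_branch r (poly_eval d p) U f ->
  (forall x, U x -> f x <> RtoC 0 /\ is_pseries g x (1 / f x)%C) -> U a ->
  exists D : Defs.C, is_pseries (fun n => RtoC (INR n) * g n)%C a D /\
    (r * D * poly_eval d p a +
     1 / f a * sum_n (fun k => p k * (RtoC (INR k) * a ^ k))%C d)%C = RtoC 0.
Proof.
  intros Hr HU (L & HL & Hexp & Hf) Hg Ha.
  assert (Hloc : locally 1 (fun t => U (RtoC t * a)%C)).
  { apply locally_ray; [exact HU | now rewrite Cmult_1_l]. }
  destruct (is_derive_C_pseries_ray g a (fun t => 1 / f (RtoC t * a))%C 1)
    as (D & HD & HDs).
  { revert Hloc. apply filter_imp. intros t Ht. now apply Hg. }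
  rewrite !Cmult_1_l in HDs.
  destruct (analytic_on_is_derive_C_ray U L a HL Ha) as (E & HE).
  exists D. split; [exact HDs |].
  assert (Hp : (E * poly_eval d p a)%C
               = sum_n (fun k => p k * (RtoC (INR k) * a ^ k))%C d).
  { apply is_derive_C_unique with (2 := is_derive_C_ray_poly_eval d p a).
    generalize (is_derive_C_Cexp _ _ _ HE).
    rewrite Cmult_1_l, Hexp by exact Ha.
    apply is_derive_C_ext_loc. revert Hloc. apply filter_imp. intros t. apply Hexp. }
  assert (HDf : (D * f a + 1 / f a * (1 / r * E * f a))%C = RtoC 0).
  { apply is_derive_C_unique with (fun _ : R => RtoC 1) 1; [| apply is_derive_C_const].
    assert (HE' := is_derive_C_mult _ _ _ _ _ (is_derive_C_const (1 / r)%C 1) HE).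
    rewrite Cmult_0_l, Cplus_0_l in HE'.
    generalize (is_derive_C_mult _ _ _ _ _ HD (is_derive_C_Cexp _ _ _ HE')).
    rewrite Cmult_1_l, <- Hf by exact Ha.
    apply is_derive_C_ext_loc. revert Hloc. apply filter_imp. intros t Ht.
    rewrite <- Hf by exact Ht. field. now apply Hg. }
  assert (Hfa : f a <> RtoC 0) by now apply Hg.
  (* This is the previous identity solved for [D]. *)
  replace D with (- (1 / f a) * (1 / r) * E)%C.
  - rewrite <- Hp. field. now split.
  - transitivity (((D * f a + 1 / f a * (1 / r * E * f a)) / f a
                  - 1 / f a * (1 / r * E)))%C.
    + rewrite HDf. field. now split.
    + field. now split.
Qed.

Open Scope C_scope.

Theorem theorem1 :
  forall (r : Complex.C) (d : nat) (p g : nat -> Complex.C),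
    r <> RtoC 0 ->
    p d <> RtoC 0 ->
    is_expansion_inv_root r (poly_eval d p) g ->
    forall n : nat, (d + 1 <= n)%nat ->
      sum_n (fun t : nat =>
               ((r * RtoC (INR n) - r * RtoC (INR t) + RtoC (INR t))
                * p t * g (n - t)%nat)%C) d
      = RtoC 0.
Proof.
  intros r d p g Hr _ (_ & U & f & HU & _ & Hne & _ & Hroot & Hg) n Hn.
  (* [w k m] is what the monomial [p k * x ^ k] of the polynomial and the term [g m * x ^ m]
     together contribute to [r p (x g') + (x p') g], at index [m + k]. *)
  set (w := fun k m : nat =>
              ((r * RtoC (INR m) + RtoC (INR k)) * p k * g m)%C).
  assert (Hz : forall x, U x ->
    is_pseries (fun m => sum_n (fun k => PS_incr_n (w k) k m) d) x (RtoC 0)).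
  { intros a Ha.
    destruct (inv_root_Euler_identity r d p g U f a Hr HU Hroot Hg Ha) as (D & HD & HE).
    destruct (Hg a Ha) as [_ HG].
    (* The zero value is unfolded as a sum over the monomials of [p], each a shift by [k] of a
       combination of the series of [D] and of [1 / f a]. *)
    replace (RtoC 0) with
      (sum_n (fun k => a ^ k * (p k * r * D + p k * RtoC (INR k) * (1 / f a)))%C d).
    - apply (is_pseries_sum_n (V := C_NormedModule)). intros k.
      rewrite <- C_pow_n. apply (is_pseries_incr_n (V := C_NormedModule)).
      eapply is_pseries_ext,
        (is_pseries_plus _ _ _ _ _
           (is_pseries_scal (p k * r)%C _ _ _ (Cmult_comm _ _) HD)
           (is_pseries_scal (p k * RtoC (INR k))%C _ _ _ (Cmult_comm _ _) HG)).
      intros m. unfold w.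
      change (p k * r * (RtoC (INR m) * g m) + p k * RtoC (INR k) * g m =
              (r * RtoC (INR m) + RtoC (INR k)) * p k * g m)%C. ring.
    - rewrite <- HE. unfold poly_eval.
      generalize (1 / f a)%C. intros G. clear.
      match goal with |- ?x = ?y => change (@eq Defs.C x y) end.
      induction d as [| d IH].
      + rewrite !sum_O. ring.
      + rewrite !sum_Sn, IH.
        change (plus ?x ?y) with (x + y)%C. ring. }
  rewrite <- (pseries_C_locally_zero U _ HU Hne Hz n).
  apply sum_n_ext_loc. intros k Hk.
  rewrite PS_incr_n_simplify.
  (* Since [k <= d < n], the default 0 of the shifted series is never taken and [n - k] is a true
     difference. *)
  destruct (Compare_dec.le_lt_dec k n) as [Hkn | Hkn]; [| lia].
  unfold w. rewrite minus_INR by exact Hkn. rewrite RtoC_minus.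
  f_equal. f_equal. ring.
Qed.
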